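(* Let $N\ge 0$, $j\ge 0$ and $n\ge 0$ be integers. Let $U_{N,j}(n)$ be the number of partitions $\pi=(\lambda_1,\lambda_2,\dots)$ with all parts $\le N$ such that $\mathcal{O}(\pi)=n$ and $\gamma(\pi)=j$. Let $T_{N,j}(n)$ be the number of 2-color partitions (parts colored red or green) of $n$ such that exactly $j$ parts are red and the largest green part does not exceed $N-j$. Then $U_{N,j}(n)=T_{N,j}(n)$.
   Context: A partition $\pi=(\lambda_1,\lambda_2,\dots)$ is a finite non-increasing sequence of positive integers (its parts); the empty sequence is the unique partition of $0$. $\mathcal{O}(\pi)=\lambda_1+\lambda_3+\lambda_5+\cdots$ is the sum of the odd-indexed parts, and $\gamma(\pi)=\lambda_1-\lambda_2+\lambda_3-\lambda_4+\cdots$ is the alternating sum of parts. In a 2-color partition each part carries one of two colors, and partitions differing only in colors of parts are distinct; the order of parts is irrelevant. *)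

(* Defs.v *)
From HB Require Import structures.
From mathcomp Require Import all_boot all_order all_algebra.
From mathcomp Require Import finmap multiset.
From mathcomp Require Import boolp classical_sets functions cardinality.

Set Implicit Arguments.
Unset Strict Implicit.
Unset Printing Implicit Defensive.

Import Order.TTheory GRing.Theory Num.Theory.

Local Open Scope classical_set_scope.
Local Open Scope ring_scope.

Definition is_partition (s : seq nat) : bool :=
  sorted geq s && all (fun x => 0 < x)%N s.

(* The parts are indexed from 1 on paper and from 0 here, so lambda_i is
   nth 0 s i.-1 and the odd-indexed parts are those in even position. *)
Definition odd_index_sum (s : seq nat) : nat :=
  (\sum_(i < size s | ~~ odd i) nth 0 s i)%N.

Definition alt_sum (s : seq nat) : int :=
  \sum_(i < size s) (-1) ^+ i * (nth 0%N s i)%:Z.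

Definition U_set (N j n : nat) : set (seq nat) :=
  [set s | [/\ is_partition s, all (fun x => x <= N)%N s,
               odd_index_sum s = n & alt_sum s = j%:Z]].

Variant color := Red | Green.

Definition is_red (c : color) : bool := if c is Red then true else false.
Definition color_of_bool (b : bool) : color := if b then Red else Green.
Lemma is_redK : cancel is_red color_of_bool. Proof. by case. Qed.

HB.instance Definition _ := Finite.copy color (can_type is_redK).

Notation colored_part := (color * nat)%type.

Definition is_partition2 (m : {mset colored_part}%mset) : bool :=
  all (fun x => 0 < x.2)%N m.

Definition weight2 (m : {mset colored_part}%mset) : nat :=
  (\sum_(x <- m) x.2)%N.

Definition red_parts (m : {mset colored_part}%mset) : nat :=
  count (fun x => x.1 == Red) m.

(* Equal to 0 when there is no green part. *)
Definition largest_green (m : {mset colored_part}%mset) : nat :=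
  (\max_(x <- m | x.1 == Green) x.2)%N.

(* N - j is an integer difference: for N < j no 2-color partition qualifies,
   not even one without green parts. *)
Definition T_set (N j n : nat) : set {mset colored_part}%mset :=
  [set m | [/\ is_partition2 m, weight2 m = n, red_parts m = j &
               (largest_green m)%:Z <= N%:Z - j%:Z]].

Lemma finite_bounded_seqs (T : choiceType) (r : seq T) (k : nat) :
  finite_set [set s : seq T | (size s <= k)%N /\ {subset s <= r}].
Proof.
elim: k => [|k IHk].
  by apply: (sub_finite_set _ (finite_set1 [::])) => -[|x s] [].
apply: (@sub_finite_set _ _
  ([set [::]] `|` [set x :: s | x in [set` r] &
     s in [set s : seq T | (size s <= k)%N /\ {subset s <= r}]])).
  case=> [|x s] [ss sr]; first by left.
  right; exists x; first by apply: sr; rewrite mem_head.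
  exists s => //; split=> // y ys; apply: sr; by rewrite in_cons ys orbT.
rewrite finite_setU; split; first exact: finite_set1.
by apply: finite_image2 => //; exact: finite_seq.
Qed.

(* fset_set is the empty set on an infinite argument, so the cardinals below
   count U_set and T_set because both are finite. *)
Lemma finite_U_set (N j n : nat) : finite_set (U_set N j n).
Proof.
apply: sub_finite_set (finite_bounded_seqs (iota 0 N.+1) n.*2).
move=> s [/andP[_ /allP s0] /allP sN <- _]; split; last first.
  by move=> x xs; rewrite mem_iota add0n ltnS sN.
suff: (uphalf (size s) <= odd_index_sum s)%N.
  by rewrite -leq_double; apply: leq_trans; rewrite uphalf_half doubleD
     -[X in (X <= _)%N]odd_double_half leq_add2r; case: odd.
have -> : uphalf (size s) = (\sum_(i < size s | ~~ odd i) 1)%N.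
  elim: (size s) => [|k IHk]; first by rewrite big_ord0.
  rewrite big_mkcond big_ord_recr -big_mkcond /= -IHk uphalfE /= uphalf_half.
  by case: odd; rewrite addnC ?addn0.
by apply: leq_sum => i _; apply: s0; rewrite mem_nth.
Qed.

Lemma finite_T_set (N j n : nat) : finite_set (T_set N j n).
Proof.
set r := [seq (c, x) | c <- [:: Red; Green], x <- iota 0 n.+1].
apply: sub_finite_set
  (finite_image (@seq_mset colored_part) (finite_bounded_seqs r n)).
move=> m [/allP m0 wm _ _]; exists (m : seq _); last exact: seq_mset_id.
split.
  rewrite -sum1_size -wm /weight2 big_seq [leqRHS]big_seq.
  by apply: leq_sum => x /m0.
case=> c x xm; apply/allpairsP; exists (c, x); split=> //=; first by case: (c).
rewrite -[_ :: _]/(iota 0 n.+1) mem_iota add0n ltnS /=.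
by rewrite -wm /weight2 (big_rem _ xm) leq_addr.
Qed.

Definition U_count (N j n : nat) : nat := #|` fset_set (U_set N j n)|%fset.

Definition T_count (N j n : nat) : nat := #|` fset_set (T_set N j n)|%fset.

(* Main.v *)
(** Put [A_i = lambda_i - lambda_(i+1) + lambda_(i+2) - ...].  Then
    [lambda_i = A_i + A_(i+1)], and [lambda] is non-increasing exactly when
    [A_i >= A_(i+2)] for all [i].  So [lambda] is the same thing as the pair of
    partitions [p = (A_1, A_3, ...)] and [q = (A_2, A_4, ...)]; the alternating
    sum is the largest part of [p], the largest part of [lambda] is the sum of
    the largest parts of [p] and [q], and the sum of the odd-indexed parts is
    [|p| + |q|].  Colouring the parts of the conjugate of [p] red and those of
    [q] green gives the bijection. *)
From mathcomp Require Import all_boot all_order all_algebra.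
From mathcomp Require Import finmap multiset zify.
From mathcomp Require Import classical_sets cardinality.
Require Import Defs.

Set Implicit Arguments.
Unset Strict Implicit.
Unset Printing Implicit Defensive.

Import Order.TTheory GRing.Theory Num.Theory.

(** * Partitions and their two sums, part by part *)

Lemma is_partition_cons x s :
  is_partition (x :: s) = [&& 0 < x, head 0 s <= x & is_partition s].
Proof.
rewrite /is_partition /=; case: s => [|y s] /=; first by rewrite andbT.
by rewrite -!andbA; do !bool_congr.
Qed.

Lemma is_partition_head_le s : is_partition s -> all (leq^~ (head 0 s)) s.
Proof.
case: s => //= x s /andP[/= xs _]; rewrite leqnn /=.
by apply: order_path_min xs => a b c /= ba cb; apply: leq_trans cb ba.
Qed.

Lemma is_partition_all_leq N s :
  is_partition s -> all (leq^~ N) s = (head 0 s <= N).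
Proof.
move=> ps; apply/idP/idP; first by case: s ps => //= x s _ /andP[].
move=> sN; apply: sub_all (is_partition_head_le ps) => x /= xs.
exact: leq_trans xs sN.
Qed.

Lemma perm_is_partition_eq s t :
  is_partition s -> is_partition t -> perm_eq s t -> s = t.
Proof.
move=> /andP[ss _] /andP[st _]; apply: sorted_eq ss st.
  by move=> a b c /= ba cb; apply: leq_trans cb ba.
by move=> a b /=; rewrite andbC => /anti_leq.
Qed.

Lemma odd_index_sum_cons x s :
  odd_index_sum (x :: s) = x + odd_index_sum (behead s).
Proof.
rewrite /odd_index_sum big_mkcond big_ord_recl /=; congr addn.
case: s => [|y s] /=; first by rewrite !big_ord0.
rewrite big_ord_recl /= add0n [RHS]big_mkcond.
by apply: eq_bigr => i _; rewrite /= negbK.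
Qed.

Lemma alt_sum_cons x s : alt_sum (x :: s) = (x%:Z - alt_sum s)%R.
Proof.
rewrite /alt_sum big_ord_recl expr0 mul1r; congr (_ + _)%R.
by rewrite -sumrN; apply: eq_bigr => i _; rewrite exprS mulN1r mulNr.
Qed.

(** The even-indexed parts of [s] are the odd-indexed parts of its tail. This turns alternating sums
    into linear arithmetic. *)
Lemma alt_sumE s :
  alt_sum s = ((odd_index_sum s)%:Z - (odd_index_sum (behead s))%:Z)%R.
Proof.
elim: s => [|x s IHs]; first by rewrite /alt_sum /odd_index_sum !big_ord0.
rewrite alt_sum_cons IHs odd_index_sum_cons /=; lia.
Qed.

(** * Alternating tails *)

(* A null alternating tail is not recorded: in a partition the later ones of
   the same parity then vanish too. *)
Definition pcons (x : nat) (s : seq nat) : seq nat :=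
  if 0 < x then x :: s else s.

(** The pair (A_1, A_3, ...), (A_2, A_4, ...). A new first part shifts every index by one, so the
    two components swap, and the new A_1 is [x] minus the old one. On partitions the truncated
    subtraction is exact, by the head identity of [alt_tailsP]. *)
Fixpoint alt_tails (s : seq nat) : seq nat * seq nat :=
  if s is x :: s' then
    let pq := alt_tails s' in (pcons (x - head 0 pq.1) pq.2, pq.1)
  else ([::], [::]).

Lemma is_partition_pcons x s :
  head 0 s <= x -> is_partition s ->
  is_partition (pcons x s) /\ head 0 (pcons x s) = x.
Proof.
rewrite /pcons; case: posnP => [->|x0] sx ps; last first.
  by rewrite is_partition_cons x0 sx.
by split=> //; move: sx; rewrite leqn0 => /eqP.
Qed.

(** The head identity drives the induction: [x >= head 0 s = head 0 p + head 0 q] gives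
    [x - head 0 p >= head 0 q], so the new tail may be put in front of [q]. *)
Lemma alt_tailsP s : is_partition s ->
  [/\ is_partition (alt_tails s).1, is_partition (alt_tails s).2 &
      head 0 (alt_tails s).1 + head 0 (alt_tails s).2 = head 0 s].
Proof.
elim: s => //= x s IHs; rewrite is_partition_cons => /and3P[x0 sx /IHs].
case: (alt_tails s) => p q /= [pp pq hs].
have [||pc hc] := @is_partition_pcons (x - head 0 p) q => //; first by lia.
by split=> //; rewrite hc; lia.
Qed.

Lemma sumn_pcons x s : sumn (pcons x s) = x + sumn s.
Proof. by rewrite /pcons; case: posnP => [->|]. Qed.

(** A new part [x] adds [x - head 0 p = x - alt_sum s] to the total; by [alt_sumE] this turns
    [odd_index_sum s] into [x + odd_index_sum (behead s)]. *)
Lemma alt_tails_sum s : is_partition s ->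
  sumn (alt_tails s).1 + sumn (alt_tails s).2 = odd_index_sum s /\
  Posz (head 0 (alt_tails s).1) = alt_sum s.
Proof.
elim: s => [|x s IHs] ps.
  by rewrite /odd_index_sum /alt_sum !big_ord0.
have := ps; rewrite is_partition_cons => /and3P[x0 sx ps'].
have [_ _ hxs] := alt_tailsP ps.
have [pp pq hs] := alt_tailsP ps'; have [IH1 IH2] := IHs ps'.
rewrite alt_sum_cons -IH2 odd_index_sum_cons.
move: (alt_sumE s); rewrite -IH2 -IH1.
move: hxs hs => /=; rewrite sumn_pcons.
case: (alt_tails s) => p q /=; set h := head 0 (pcons _ _) => hxs hs e.
by split; lia.
Qed.

Lemma alt_tails_inj s t : is_partition s -> is_partition t ->
  alt_tails s = alt_tails t -> s = t.
Proof.
elim: s t => [|x s IHs] [|y t] //.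
- move=> _ pt e; have [_ _] := alt_tailsP pt; rewrite -e /=.
  by move: pt; rewrite is_partition_cons; case: y {e}.
- move=> ps _ e; have [_ _] := alt_tailsP ps; rewrite e /=.
  by move: ps; rewrite is_partition_cons; case: x {e}.
move=> ps pt e.
have xy : x = y.
  have [_ _ hx] := alt_tailsP ps; have [_ _ hy] := alt_tailsP pt.
  by rewrite -[x]hx -[y]hy e.
move: ps pt; rewrite !is_partition_cons => /and3P[_ _ ps] /and3P[_ _ pt].
rewrite -xy in e *; congr cons; apply: IHs => //.
move: e => /=.
(* As the second components agree, both [pcons] get the same first argument, so a null tail is
   dropped on both sides or on neither. *)
case: (alt_tails s) (alt_tails t) => [p q] [p' q'] /= [+ pp]; rewrite -pp.
by rewrite /pcons; case: ifP => _ => [[->]|->].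
Qed.

(** Since lambda_1 = A_1 + A_2, the first part is forced, and the rest must have the swapped pair
    without A_1 as its tails. Hence the induction on the total size. *)
Lemma alt_tails_surj p q : is_partition p -> is_partition q ->
  exists2 s, is_partition s & alt_tails s = (p, q).
Proof.
have cons_case x p' q' : 0 < x -> is_partition (x :: p') ->
    (exists2 s, is_partition s & alt_tails s = (q', p')) ->
    exists2 s, is_partition s & alt_tails s = (x :: p', q').
  move=> x0; rewrite is_partition_cons => /and3P[_ px pp] [s ps es].
  exists (x + head 0 q' :: s); last by rewrite /= es /= addnK /pcons x0.
  have [_ _] := alt_tailsP ps; rewrite es is_partition_cons ps /=; lia.
have [n] := ubnP (size p + size q); elim: n p q => // n IHn.
have pos x t : is_partition (x :: t) -> 0 < x /\ is_partition t.
  by rewrite is_partition_cons => /and3P[].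
case=> [|x p] q sz pp pq; last first.
  have [x0 pp'] := pos _ _ pp; apply: cons_case => //; apply: IHn => //.
  by move: sz => /=; lia.
case: q sz pq => [|y q] sz pq; first by exists [::].
have [y0 pq'] := pos _ _ pq.
have [|s ps es] := cons_case y q [::] y0 pq.
  by apply: IHn => //; move: sz => /=; lia.
(* Here A_1 = 0, so the first two parts coincide: [s] already begins with [y]. *)
exists (y :: s); last by rewrite /= es /= subnn.
have [_ _] := alt_tailsP ps; rewrite es is_partition_cons ps /=; lia.
Qed.

(** * Conjugate partitions *)

(* A new largest row lengthens every column by one and adds columns of height
   one. *)
Fixpoint conj_parts (p : seq nat) : seq nat :=
  if p is x :: p' then
    map succn (conj_parts p') ++ nseq (x - size (conj_parts p')) 1
  else [::].

Lemma all_conj_parts_gt0 p : all (ltn 0) (conj_parts p).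
Proof.
elim: p => //= x p _; rewrite all_cat all_map all_nseq orbT andbT.
exact/allP.
Qed.

Lemma size_conj_parts p : is_partition p -> size (conj_parts p) = head 0 p.
Proof.
elim: p => //= x p IHp; rewrite is_partition_cons => /and3P[_ px /IHp e].
by rewrite size_cat size_map size_nseq e subnKC.
Qed.

Lemma sumn_conj_parts p : is_partition p -> sumn (conj_parts p) = sumn p.
Proof.
elim: p => //= x p IHp; rewrite is_partition_cons => /and3P[_ px pp].
have sumnS s : sumn (map succn s) = sumn s + size s.
  by elim: s => //= y s ->; rewrite !addSn addnS addnA.
rewrite sumn_cat sumnS sumn_nseq mul1n size_conj_parts // IHp //; lia.
Qed.

(* Removing a first column inverts one step of [conj_parts]. *)
Lemma conj_parts_consK x p :
  map predn (filter (ltn 1) (conj_parts (x :: p))) = conj_parts p.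
Proof.
rewrite /= filter_cat filter_nseq cats0 filter_map -map_comp.
rewrite (eq_map (g := id)) // map_id.
by apply/all_filterP; apply: sub_all (all_conj_parts_gt0 p).
Qed.

(** The number of columns gives the largest row, and removing the first column of the original
    diagram's conjugate via [conj_parts_consK] respects permutations, so the remaining rows follow
    by induction. *)
Lemma conj_parts_inj p p' : is_partition p -> is_partition p' ->
  perm_eq (conj_parts p) (conj_parts p') -> p = p'.
Proof.
elim: p p' => [|x p IHp] [|x' p'] //.
- move=> _ px /perm_size; rewrite !size_conj_parts //=.
  by move: px; rewrite is_partition_cons; case: x'.
- move=> px _ /perm_size; rewrite !size_conj_parts //=.
  by move: px; rewrite is_partition_cons; case: x.
move=> px px' e; have := perm_size e; rewrite !size_conj_parts //= => <-.
move: px px'; rewrite !is_partition_cons => /and3P[_ _ pp] /and3P[_ _ pp'].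
congr cons; apply: IHp => //.
rewrite -(conj_parts_consK x p) -(conj_parts_consK x' p').
by apply: perm_map; apply: perm_filter.
Qed.

Lemma conj_parts_surj r : all (ltn 0) r ->
  exists2 p, is_partition p & perm_eq (conj_parts p) r.
Proof.
have [n] := ubnP (sumn r); elim: n r => // n IHn r.
case: (posnP (size r)) => [/size0nil -> _ _|sr rn r0]; first by exists [::].
(* The largest row will be [size r]; removing it shortens every column by one and deletes the
   columns of height one. *)
set r1 := filter (ltn 1) r.
have r1E : map succn (map predn r1) = r1.
  rewrite -map_comp -[RHS]map_id; apply/eq_in_map => y.
  by rewrite mem_filter => /andP[/= y1 _]; rewrite prednK // ltnW.
have r2E : filter (predC (ltn 1)) r = nseq (size r - size r1) 1.
  have -> : size r - size r1 = size (filter (predC (ltn 1)) r).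
    by rewrite !size_filter -(count_predC (ltn 1) r) addKn.
  apply/all_pred1P/allP => y; rewrite mem_filter /= => /andP[y1 /(allP r0)] /=.
  by move: y1; case: y => [|[|y]].
have rE : perm_eq (r1 ++ nseq (size r - size r1) 1) r.
  by rewrite -r2E; apply/permPl/perm_filterC.
have [||p pp ep] := IHn (map predn r1).
(* The sum drops by [size r], which is positive. *)
- have sumnP s : all (ltn 0) s -> sumn (map predn s) + size s = sumn s.
    elim: s => //= y s IHs /andP[y0 /IHs <-]; lia.
  have r1r : size r1 <= size r by rewrite size_filter count_size.
  have := perm_sumn rE; rewrite sumn_cat sumn_nseq mul1n.
  have := sumnP r1; rewrite (sub_all _ (filter_all _ _)) => [/(_ isT)|[]//].
  lia.
- by apply/allP => _ /mapP[y + ->]; rewrite mem_filter; case: y => [|[]].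
have szp : size (conj_parts p) = size r1 by rewrite (perm_size ep) size_map.
exists (size r :: p).
  rewrite is_partition_cons sr pp -size_conj_parts // szp.
  by rewrite size_filter count_size.
apply: perm_trans rE; rewrite /= szp perm_cat2r -r1E.
exact: perm_map.
Qed.

(** * The bijection *)

Definition coloring (r g : seq nat) : seq colored_part :=
  map (pair Red) r ++ map (pair Green) g.

Definition parts_of_color (c : color) (m : seq colored_part) : seq nat :=
  [seq x.2 | x <- m & x.1 == c].

Lemma parts_of_color_coloring r g :
  parts_of_color Red (coloring r g) = r /\
  parts_of_color Green (coloring r g) = g.
Proof.
have E c d t : parts_of_color c (map (pair d) t) = if d == c then t else [::].
  rewrite /parts_of_color.
  by elim: t => [|y t] /=; case: (d == c) => //= ->.
rewrite /coloring /parts_of_color !filter_cat !map_cat.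
by rewrite -!/(parts_of_color _ _) !E cats0.
Qed.

Lemma perm_coloring m :
  perm_eq (coloring (parts_of_color Red m) (parts_of_color Green m)) m.
Proof.
have E c : map (pair c) (parts_of_color c m) = [seq x <- m | x.1 == c].
  rewrite -map_comp -[RHS]map_id; apply/eq_in_map => -[d y].
  by rewrite mem_filter /= => /andP[/eqP->].
rewrite /coloring !E.
rewrite -[X in _ ++ X](eq_filter (a1 := predC (fun x => x.1 == Red))).
  exact/permPl/perm_filterC.
by case=> [[] y].
Qed.

(** Only the first component is conjugated: its largest part must become the number of red parts,
    whereas that of the second must stay the largest green part. *)
Definition two_color_of (s : seq nat) : {mset colored_part}%mset :=
  seq_mset (coloring (conj_parts (alt_tails s).1) (alt_tails s).2).

Lemma perm_two_color_of s :
  perm_eq (two_color_of s)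
    (coloring (conj_parts (alt_tails s).1) (alt_tails s).2).
Proof. exact: perm_eq_seq_mset. Qed.

Lemma two_color_of_inj s t : is_partition s -> is_partition t ->
  two_color_of s = two_color_of t -> s = t.
Proof.
move=> ps pt /eq_seq_msetP e; apply: alt_tails_inj => //.
have [ps1 ps2 _] := alt_tailsP ps; have [pt1 pt2 _] := alt_tailsP pt.
have ec c := perm_map snd (perm_filter (fun x => x.1 == c) e).
have := ec Green; have := ec Red.
rewrite -!/(parts_of_color _ _) !(parts_of_color_coloring _ _).1.
rewrite !(parts_of_color_coloring _ _).2.
move=> /conj_parts_inj-/(_ ps1 pt1) e1 /perm_is_partition_eq-/(_ ps2 pt2) e2.
by rewrite [LHS]surjective_pairing e1 e2 -surjective_pairing.
Qed.

Lemma two_color_of_surj m : is_partition2 m ->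
  exists2 s, is_partition s & two_color_of s = m.
Proof.
move=> m0.
have pos c : all (ltn 0) (parts_of_color c m).
  apply/allP => _ /mapP[x + ->]; rewrite mem_filter => /andP[_].
  exact: (allP m0).
have [p pp ep] := conj_parts_surj (pos Red).
pose q := sort geq (parts_of_color Green m).
have eq_q : perm_eq q (parts_of_color Green m) by rewrite perm_sort.
have pq : is_partition q.
  apply/andP; split; last by rewrite all_sort pos.
  by apply: sort_sorted => a b; exact: leq_total.
have [s ps es] := alt_tails_surj pp pq; exists s => //.
rewrite /two_color_of es /= -[RHS]seq_mset_id; apply/eq_seq_msetP.
apply: perm_trans (perm_coloring m); rewrite /coloring.
by apply: perm_cat; apply: perm_map.
Qed.

Lemma U_set_two_color N j n s : is_partition s ->
  U_set N j n s <-> T_set N j n (two_color_of s).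
Proof.
move=> ps; have [pp pq hs] := alt_tailsP ps.
have [so sa] := alt_tails_sum ps.
have P := perm_two_color_of s.
have w : weight2 (two_color_of s) = odd_index_sum s.
  rewrite /weight2 (perm_big _ P) /= big_cat !big_map /=.
  by rewrite -!sumnE sumn_conj_parts.
have r : red_parts (two_color_of s) = head 0 (alt_tails s).1.
  rewrite /red_parts (permP P) -size_filter -(size_map snd).
  rewrite -/(parts_of_color Red _) (parts_of_color_coloring _ _).1.
  exact: size_conj_parts.
have g : largest_green (two_color_of s) = head 0 (alt_tails s).2.
  rewrite /largest_green (perm_big _ P) /= big_cat !big_map /=.
  rewrite big_pred0 // max0n.
  apply/eqP; rewrite eqn_leq; apply/andP; split.
    by apply/bigmax_leqP_seq => x /(allP (is_partition_head_le pq)).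
  by case: (alt_tails s).2 => //= y q; rewrite big_cons leq_maxl.
have p2 : is_partition2 (two_color_of s).
  rewrite /is_partition2 (perm_all _ P) all_cat !all_map.
  by rewrite (all_conj_parts_gt0 _); case/andP: pq.
rewrite /U_set /T_set /= w r g is_partition_all_leq // -hs -sa ps p2.
(* With A_1 = j, the bound A_1 + A_2 <= N reads A_2 <= N - j over the integers; for N < j both sides
   fail. *)
by split=> -[_ A B C]; split=> //; lia.
Qed.

Lemma image_two_color_of N j n :
  (two_color_of @` U_set N j n)%classic = T_set N j n.
Proof.
apply/seteqP; split=> [_ [s Us <-]|m Tm].
  by apply/U_set_two_color; case: Us.
have [s ps em] := two_color_of_surj (let: And4 h _ _ _ := Tm in h).
by exists s => //; apply/U_set_two_color; rewrite ?em.
Qed.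

Theorem theorem1p3 (N j n : nat) : U_count N j n = T_count N j n.
Proof.
rewrite /U_count /T_count -image_two_color_of fset_set_image; last first.
  exact: finite_U_set.
rewrite card_in_imfset // => s t.
rewrite !in_fset_set; try exact: finite_U_set.
rewrite !inE => -[ps _ _ _] [pt _ _ _]; exact: two_color_of_inj.
Qed.
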